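(* Let $\Sigma$ be a finite alphabet with at least two symbols. There is no algorithm with oracle access which, for every eventually strongly almost periodic sequence $\omega\in\Sigma^{\mathbb{N}}$, every almost periodicity regulator $f$ of $\omega$ and every natural number $l\ge\mathrm{pr}(\omega)$, given oracle access to $\omega$ and $f$ and given $l$ as input, halts and outputs $\mathrm{pr}(\omega)$.
   Context: For a sequence $\omega$, write $\omega[i,j]=\omega(i)\dots\omega(j)$ and $\omega[i,\infty)$ for the suffix starting at $i$; a factor is a nonempty string $\omega[i,j]$. A sequence is strongly almost periodic (SAP) if for every factor $x$ there is $l$ such that every factor of length $l$ contains an occurrence of $x$; it is eventually strongly almost periodic if some suffix is SAP, and $\mathrm{pr}(\omega)$ is the least $m$ with $\omega[m,\infty)$ SAP. A function $r\colon\mathbb{N}\to\mathbb{N}$ is an almost periodicity regulator of $\omega$ if (1) every string of length $k$ occurring in $\omega$ infinitely many times occurs in every factor of $\omega$ of length $r(k)$, and (2) every string of length $k$ occurring in $\omega$ only finitely many times does not occur in $\omega[r(k),\infty)$. An algorithm with oracle access to $\omega$ and $f$ may query values $\omega(i)$ and $f(i)$. *)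

(* Defs.v *)
From mathcomp Require Import all_boot.

Set Implicit Arguments.
Unset Strict Implicit.
Unset Printing Implicit Defensive.

Section Sequences.

Variable Sigma : Type.

Implicit Type w : nat -> Sigma.

(* The string w(i) ... w(i + n - 1), given by its start and its length. *)
Definition factor w (i n : nat) : seq Sigma := mkseq (fun k => w (i + k)) n.

Definition suffix_from w (m : nat) : nat -> Sigma := fun i => w (m + i).

End Sequences.

Section AlmostPeriodicity.

Variable Sigma : eqType.

Implicit Types (w : nat -> Sigma) (x : seq Sigma).

Definition occurs_at w x (i : nat) : bool := factor w i (size x) == x.

(* The case l = 0 is harmless: a nonempty string is not an infix of [::]. *)
Definition strongly_almost_periodic w : Prop :=
  forall i n : nat, 0 < n ->
    exists l : nat, forall j : nat, infix (factor w i n) (factor w j l).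

Definition eventually_strongly_almost_periodic w : Prop :=
  exists m : nat, strongly_almost_periodic (suffix_from w m).

(* The graph of pr: m is the least start of a strongly almost periodic
   suffix of w. *)
Definition is_pr w (m : nat) : Prop :=
  strongly_almost_periodic (suffix_from w m) /\
  forall m' : nat, strongly_almost_periodic (suffix_from w m') -> m <= m'.

Definition occurs_infinitely_often w x : Prop :=
  forall N : nat, exists2 i : nat, N <= i & occurs_at w x i.

(* This includes the strings with no occurrence at all. *)
Definition occurs_finitely_often w x : Prop :=
  exists N : nat, forall i : nat, occurs_at w x i -> i < N.

(* In the first clause, as above, a window of length 0 contains no nonempty
   string, so f k = 0 does not satisfy it vacuously for k > 0. *)
Definition regulator w (f : nat -> nat) : Prop :=
  (forall (k : nat) x, size x = k -> occurs_infinitely_often w x ->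
     forall j : nat, infix x (factor w j (f k))) /\
  (forall (k : nat) x, size x = k -> occurs_finitely_often w x ->
     forall j : nat, f k <= j -> ~~ occurs_at w x j).

End AlmostPeriodicity.

(* Algorithms are unlimited register machines in the sense of Shepherdson and
   Sturgis, extended with one query instruction for each of two oracles.  The
   registers hold arbitrary natural numbers and are indexed by nat; a query
   replaces the content of a register by the oracle's answer at it. *)
Inductive instr : Type :=
  | Zero of nat
  | Succ of nat
  | Copy (src dst : nat)
  | JumpEq (r s target : nat)
  | QueryA of nat
  | QueryB of nat.

Definition program := seq instr.

Definition registers := nat -> nat.

(* Program counter and register contents. *)
Definition config := (nat * registers)%type.

Definition update (rho : registers) (r v : nat) : registers :=
  fun s => if s == r then v else rho s.

Definition exec (a b : nat -> nat) (ins : instr) (c : config) : config :=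
  let: (pc, rho) := c in
  match ins with
  | Zero r => (pc.+1, update rho r 0)
  | Succ r => (pc.+1, update rho r (rho r).+1)
  | Copy src dst => (pc.+1, update rho dst (rho src))
  | JumpEq r s target => (if rho r == rho s then target else pc.+1, rho)
  | QueryA r => (pc.+1, update rho r (a (rho r)))
  | QueryB r => (pc.+1, update rho r (b (rho r)))
  end.

(* The machine halts by leaving the program; halted configurations are
   fixed. *)
Definition step (P : program) (a b : nat -> nat) (c : config) : config :=
  if onth P c.1 is Some ins then exec a b ins c else c.

Definition halted (P : program) (c : config) : bool := size P <= c.1.

(* The input is placed in register 0, all other registers being 0. *)
Definition initial (input : nat) : config := (0, update (fun=> 0) 0 input).

Definition halts_with_output (P : program) (a b : nat -> nat)
    (input output : nat) : Prop :=
  exists t : nat,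
    let c := iter t (step P a b) (initial input) in
    halted P c /\ c.2 0 = output.

(* A sequence over a finite alphabet as a numerical oracle: symbols are coded
   by their ranks 0, ..., #|Sigma| - 1. *)
Definition sequence_oracle (Sigma : finType) (w : nat -> Sigma) : nat -> nat :=
  fun i => enum_rank (w i).

(* Main.v *)
Require Import Defs.
From mathcomp Require Import all_boot.
From mathcomp Require Import zify.

(** A halting computation reads only finitely many oracle values, so it is
   enough to find a sequence with [pr = 0] that is, together with its
   regulator, a limit of sequences with [pr = 1].  The ruler sequence
   [w i = odd (logn 2 i)] is strongly almost periodic because the symbol at
   position [0] could be any of the two: a block of length at most [2 ^ s]
   contains at most one multiple of [2 ^ s], and both symbols are taken with
   bounded gaps on these multiples.  Truncating the valuation at an odd [n]
   changes [w] only from position [2 ^ n] on; the result is periodic from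
   position [1] on, but at position [0] it shows the symbol [0] where
   periodicity would require [1].  Blocks of length less than [n] recur in the
   truncated sequences within the same windows as in [w]. *)

Set Implicit Arguments.
Unset Strict Implicit.
Unset Printing Implicit Defensive.

(** * Continuity of computations in their oracles *)

Section Execution.

Variable P : program.

Definition agree_below (N : nat) (a a' : nat -> nat) : Prop :=
  forall i, i < N -> a i = a' i.

(** A step makes at most one query, at the content of one register. *)
Lemma step_continuous a b c :
  exists N, forall a' b', agree_below N a a' -> agree_below N b b' ->
    step P a' b' c = step P a b c.
Proof.
case: c => pc rho; rewrite /step /=.
case: (onth P pc) => [[r|r|r s|r s t|r|r]|]; try by exists 0.
- by exists (rho r).+1 => a' b' eqa _ /=; rewrite eqa.
- by exists (rho r).+1 => a' b' _ eqb /=; rewrite eqb.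
Qed.

Lemma iter_step_continuous a b c t :
  exists N, forall a' b', agree_below N a a' -> agree_below N b b' ->
    iter t (step P a' b') c = iter t (step P a b) c.
Proof.
elim: t => [|t [N1 IHt]]; first by exists 0.
have [N2 stepE] := step_continuous a b (iter t (step P a b) c).
exists (maxn N1 N2) => a' b' eqa eqb /=.
rewrite IHt; first 1 last.
- by move=> i lti; apply: eqa; rewrite leq_max lti.
- by move=> i lti; apply: eqb; rewrite leq_max lti.
by apply: stepE => i lti; [apply: eqa | apply: eqb]; rewrite leq_max lti orbT.
Qed.

Lemma halted_iter_step a b c t : halted P c -> iter t (step P a b) c = c.
Proof.
move=> haltc; elim: t => //= t ->.
by rewrite /step onth_default.
Qed.

Lemma halts_with_output_inj a b l m m' :
  halts_with_output P a b l m -> halts_with_output P a b l m' -> m = m'.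
Proof.
case=> t [halt <-] [t' [halt' <-]].
have [le_tt'|/ltnW le_t't] := leqP t t'.
- by rewrite -(subnK le_tt') iterD (halted_iter_step _ _ _ halt).
- by rewrite -(subnK le_t't) iterD (halted_iter_step _ _ _ halt').
Qed.

Lemma halts_with_output_continuous a b l m :
  halts_with_output P a b l m ->
  exists N, forall a' b', agree_below N a a' -> agree_below N b b' ->
    halts_with_output P a' b' l m.
Proof.
case=> t halt; have [N iterE] := iter_step_continuous a b (initial l) t.
by exists N => a' b' eqa eqb; exists t; rewrite iterE.
Qed.

End Execution.

(** * Uniform recurrence of factors *)

Section Factors.

Variable Sigma : eqType.
Implicit Types (w : nat -> Sigma) (x : seq Sigma).

Lemma eq_factor w i j n :
  (forall d, d < n -> w (i + d) = w (j + d)) -> factor w i n = factor w j n.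
Proof.
move=> eqw; apply/eq_in_map => d; rewrite mem_iota => /andP[_ ltd].
exact: eqw.
Qed.

Lemma occurs_atP w x i : reflect (x = factor w i (size x)) (occurs_at w x i).
Proof. by rewrite /occurs_at eq_sym; apply: eqP. Qed.

Lemma factorD w i m n : factor w i (m + n) = factor w i m ++ factor w (i + m) n.
Proof.
rewrite /factor /mkseq iotaD map_cat add0n; congr (_ ++ _).
rewrite -[X in iota X]addn0 iotaDl -map_comp.
by apply: eq_map => d /=; rewrite addnA.
Qed.

Lemma infix_factor w i j k n :
  j <= i -> i + k <= j + n -> infix (factor w i k) (factor w j n).
Proof.
move=> leji lekn.
have -> : n = (i - j) + (k + (n - (i - j) - k)) by lia.
by rewrite factorD subnKC // factorD infix_infix.
Qed.

Lemma infix_factor_occurs_at w x j n :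
  infix x (factor w j n) -> exists2 i, j <= i & occurs_at w x i.
Proof.
case/infixP => p [s fE]; exists (j + size p); first exact: leq_addr.
have nE : n = size p + (size x + size s).
  by rewrite -!size_cat -fE size_mkseq.
move: fE; rewrite nE !factorD => /eqP.
rewrite eqseq_cat ?size_mkseq // => /andP[_].
by rewrite eqseq_cat ?size_mkseq // => /andP[].
Qed.

(** The start [i] is arbitrary, so a string that occurs at all occurs infinitely often. A bound for
    each [k] therefore gives strong almost periodicity and both clauses of [regulator] at once. *)
Definition recurs_within w (k n : nat) : Prop :=
  forall i j, infix (factor w i k) (factor w j n).

Lemma recurs_withinP w k n :
  (forall i j, exists2 i', j <= i' < j + n &
     forall d, d < k -> w (i' + d) = w (i + d)) ->
  recurs_within w k (n + k).
Proof.
move=> rec i j; have [i' /andP[lej lti] eqw] := rec i j.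
rewrite -(eq_factor eqw); apply: infix_factor => //; lia.
Qed.


Lemma recurs_within_finitely_often w x n :
  recurs_within w (size x) n -> occurs_finitely_often w x ->
  forall i, ~~ occurs_at w x i.
Proof.
move=> rec [N finx] i; apply/negP => /occurs_atP xE.
have := rec i N; rewrite -xE => /infix_factor_occurs_at[i' leN /finx].
by rewrite ltnNge leN.
Qed.

Lemma recurs_within_infinitely_often w x n :
  recurs_within w (size x) n -> occurs_infinitely_often w x ->
  forall j, infix x (factor w j n).
Proof. by move=> rec /(_ 0)[i _ /occurs_atP->] j; apply: rec. Qed.

Lemma recurs_within_sap w f :
  (forall k, recurs_within w k (f k)) -> strongly_almost_periodic w.
Proof. by move=> rec i k _; exists (f k) => j; apply: rec. Qed.

Lemma recurs_within_regulator w f :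
  (forall k, recurs_within w k (f k)) -> regulator w f.
Proof.
move=> rec; split=> k x sizex.
- by apply: recurs_within_infinitely_often; rewrite sizex.
- move=> finx j _; apply: recurs_within_finitely_often finx j.
  by rewrite sizex; apply: rec.
Qed.

End Factors.

(** * Residues, 2-adic valuations and recurrence of rulers *)

Lemma exists_modn_window M i j : 0 < M ->
  exists2 i', j <= i' < j + M & i' = i %[mod M].
Proof.
(* The term [M - j %% M] stands for [- j] modulo [M]. *)
move=> M_gt0; exists (j + (i + (M - j %% M)) %% M).
  by rewrite leq_addr ltn_add2l ltn_mod.
rewrite modnDmr -modnDml.
have ltj : j %% M < M by rewrite ltn_mod.
by rewrite (_ : j %% M + _ = i + M) ?modnDr //; lia.
Qed.

Lemma minn_logn2 s i : 0 < i -> minn (logn 2 i) s = logn 2 (gcdn i (2 ^ s)).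
Proof. by move=> i_gt0; rewrite logn_gcd ?expn_gt0 // pfactorK. Qed.

(** The gcd with [2 ^ s] depends only on the residue. Position [0] is excluded because
    [logn 2 0 = 0], whereas its gcd with [2 ^ s] is [2 ^ s]. *)
Lemma minn_logn2_mod s i j :
  0 < i -> 0 < j -> i = j %[mod 2 ^ s] ->
  minn (logn 2 i) s = minn (logn 2 j) s.
Proof.
by move=> i_gt0 j_gt0 eqij; rewrite !minn_logn2 // -gcdn_modl eqij gcdn_modl.
Qed.

Lemma logn2_mod s i j :
  ~~ (2 ^ s %| i) -> i = j %[mod 2 ^ s] -> logn 2 i = logn 2 j.
Proof.
move=> ndvd eqij.
have i_gt0 : 0 < i by case: i ndvd {eqij} => //; rewrite dvdn0.
have j_gt0 : 0 < j.
  by case: j eqij => // eqij; move: ndvd; rewrite /dvdn eqij mod0n.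
have := minn_logn2_mod i_gt0 j_gt0 eqij.
by move: ndvd; rewrite pfactor_dvdn // -ltnNge; lia.
Qed.

Lemma logn2_lt s i : i < 2 ^ s -> logn 2 i <= s.
Proof.
case: i => [|i lti]; first by rewrite logn0.
by rewrite -(@leq_exp2l 2) // (leq_trans _ (ltnW lti)) // dvdn_leq ?pfactor_dvdnn.
Qed.

(** Since [logn 2 0 = 0], the symbol at position [0] is [g 0]. *)
Definition ruler (T : Type) (g : nat -> T) : nat -> T := fun i => g (logn 2 i).

Lemma ruler_recurs (T : eqType) (g : nat -> T) s k :
  k <= 2 ^ s -> (forall r, g r = g s \/ g r = g s.+1) ->
  recurs_within (ruler g) k (2 ^ s.+2 + k).
Proof.
move=> lek gP; apply: recurs_withinP => i j.
have M_gt0 : 0 < 2 ^ s by rewrite expn_gt0.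
(* [p] is the first multiple of [2 ^ s] from [i] on, the only position of the block whose symbol the
   residue modulo [2 ^ s] may fail to determine. It may be [0], or lie beyond the block. *)
have [p /andP[lei ltp] pM] := exists_modn_window 0 i M_gt0.
have [e pE] : exists e, p = i + e by exists (p - i); rewrite subnKC.
have lte : e < 2 ^ s by move: ltp; rewrite pE ltn_add2l.
have [u ule gu] : exists2 u, s <= u <= s.+1 & g u = ruler g p.
  by rewrite /ruler; case: (gP (logn 2 p)) => ->;
    [exists s | exists s.+1]; rewrite ?leqnn ?leqnSn.
have [leu leus] := andP ule.
have le_s_u : 2 ^ s <= 2 ^ u by rewrite leq_exp2l.
have dvd_s_u : 2 ^ s %| 2 ^ u by rewrite dvdn_exp2l.
(* This makes [i' + e] congruent to [2 ^ u] modulo [2 ^ s.+2]. As [u < s.+2], its valuation is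
   exactly [u], and level [u] shows the symbol at [p]. *)
have [i' win i'M] :=
  exists_modn_window (2 ^ u - e) j (expn_gt0 2 s.+2 : 0 < 2 ^ s.+2).
exists i' => // d ltd; rewrite /ruler.
have i'eM : i' + e = 2 ^ u %[mod 2 ^ s.+2].
  by rewrite -modnDml i'M modnDml subnK //; lia.
have i'eM0 : i' + e = 0 %[mod 2 ^ s].
  have dv : 2 ^ s %| 2 ^ s.+2 by rewrite dvdn_exp2l //; lia.
  by rewrite -(modn_dvdm (i' + e) dv) i'eM modn_dvdm // (eqP dvd_s_u) mod0n.
have [-> | ned] := eqVneq d e.
  rewrite -pE -/(ruler g p) -gu; congr g.
  rewrite -[RHS](@pfactorK 2 u) //; symmetry; apply: (@logn2_mod s.+2) => //.
  by rewrite dvdn_Pexp2l // -ltnNge; lia.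
have eqM : i' + d = i + d %[mod 2 ^ s].
  by apply/eqP; rewrite eqn_modDr -(eqn_modDr e) i'eM0 -pE pM.
congr g; apply: logn2_mod eqM.
(* Multiples of [2 ^ s] at the offsets [d] and [e], both less than [2 ^ s], would coincide. *)
apply/negP => dvdd.
have : i' + d == i' + e %[mod 2 ^ s] by rewrite (eqP dvdd) i'eM0 mod0n.
rewrite eqn_modDl !modn_small //; first by rewrite (negPf ned).
exact: leq_trans lek.
Qed.

(** * The ruler sequence, its truncations and their regulators *)

Section Witnesses.

Variables (Sigma : eqType) (c0 c1 : Sigma).

Definition parity_symbol (r : nat) : Sigma := if odd r then c1 else c0.

Definition full_ruler : nat -> Sigma := ruler parity_symbol.

Definition capped_ruler (n : nat) : nat -> Sigma :=
  ruler (fun r => parity_symbol (minn r n)).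

Definition full_regulator (k : nat) : nat := 2 ^ k.+2 + k.

(** Agreement with [full_regulator] below [n] makes the regulators converge as well. From [n] on,
    the period gives the bound; a string may then occur at position [0] only, which the second
    clause tolerates because the bound is positive. *)
Definition capped_regulator (n k : nat) : nat :=
  if k < n then full_regulator k else (2 ^ n).+1 + k.

Lemma parity_symbol_levels s r :
  parity_symbol r = parity_symbol s \/ parity_symbol r = parity_symbol s.+1.
Proof.
rewrite /parity_symbol /=.
by case: (odd r); case: (odd s) => /=; [left|right|right|left].
Qed.

Lemma parity_symbol_inj r s :
  c0 != c1 -> parity_symbol r = parity_symbol s -> odd r = odd s.
Proof.
rewrite /parity_symbol.
by case: (odd r); case: (odd s) => // neqc eqc; rewrite eqc eqxx in neqc.
Qed.

Lemma full_ruler_recurs k : recurs_within full_ruler k (full_regulator k).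
Proof.
apply: ruler_recurs (ltnW (ltn_expl k _)) _ => // r.
exact: parity_symbol_levels.
Qed.

Lemma full_ruler_pr : is_pr full_ruler 0.
Proof. by split=> //; apply: recurs_within_sap full_ruler_recurs. Qed.

Lemma full_ruler_regulator : regulator full_ruler full_regulator.
Proof. exact: recurs_within_regulator full_ruler_recurs. Qed.

Lemma capped_ruler_eq n i : i < 2 ^ n -> capped_ruler n i = full_ruler i.
Proof.
move=> lti; rewrite /capped_ruler /full_ruler /ruler.
by rewrite (minn_idPl (logn2_lt lti)).
Qed.

(** For [k < n] the levels [k] and [k.+1] survive the truncation, and between them they carry both
    symbols. *)
Lemma capped_ruler_recurs_short n k :
  k < n -> recurs_within (capped_ruler n) k (full_regulator k).
Proof.
move=> ltkn; apply: ruler_recurs (ltnW (ltn_expl k _)) _ => // r.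
rewrite (minn_idPl ltkn) (minn_idPl (ltnW ltkn)).
exact: parity_symbol_levels.
Qed.

Lemma capped_ruler_periodic n i j :
  0 < i -> 0 < j -> i = j %[mod 2 ^ n] -> capped_ruler n i = capped_ruler n j.
Proof.
move=> i_gt0 j_gt0 eqij.
by rewrite /capped_ruler /ruler (minn_logn2_mod i_gt0 j_gt0 eqij).
Qed.

Lemma capped_ruler_recurs_pos n k i j :
  0 < i -> exists2 i', j < i' <= j + 2 ^ n &
    factor (capped_ruler n) i' k = factor (capped_ruler n) i k.
Proof.
move=> i_gt0.
have [i' /andP[ltj lti'] i'M] :=
  exists_modn_window i j.+1 (expn_gt0 2 n : 0 < 2 ^ n).
exists i'; first by rewrite ltj -ltnS.
apply: eq_factor => d _; apply: capped_ruler_periodic; try lia.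
by rewrite -modnDml i'M modnDml.
Qed.

Lemma capped_ruler_sap_suffix n :
  strongly_almost_periodic (suffix_from (capped_ruler n) 1).
Proof.
apply: (@recurs_within_sap _ _ (fun k => (2 ^ n).+1 + k)) => k.
apply: recurs_withinP => i j.
have [i' /andP[ltj lei'] i'M] :=
  exists_modn_window i j (expn_gt0 2 n : 0 < 2 ^ n).
exists i' => [|d _]; first by apply/andP; split=> //; lia.
by apply: capped_ruler_periodic => //; apply/eqP;
  rewrite eqn_modDl eqn_modDr; apply/eqP.
Qed.

Lemma capped_ruler_not_sap n :
  c0 != c1 -> odd n -> ~ strongly_almost_periodic (capped_ruler n).
Proof.
(* This prefix reaches position [2 ^ n], the largest [2 ^ v.+1] with [v < n]. The window below
   starts at [1] to yield an occurrence at a positive position. *)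
move=> neqc oddn /(_ 0 (2 ^ n).+1 isT)[l].
move=> /(_ 1)/infix_factor_occurs_at[i i_gt0].
rewrite /occurs_at size_mkseq => /eqP fE.
have wE d : d <= 2 ^ n -> capped_ruler n (i + d) = capped_ruler n d.
  move=> led; have := congr1 (nth c0 ^~ d) fE.
  by rewrite !nth_mkseq.
(* If the valuation [v] of [i] is less than [n], the symbol at [i + 2 ^ v.+1]
   is that of level [v], while the symbol at [2 ^ v.+1] is that of level
   [v.+1]; otherwise the symbol at [i] is [c1]. *)
have [len|ltn] := leqP n (logn 2 i).
  have := wE 0 (leq0n _); rewrite addn0 /capped_ruler /ruler logn0 min0n.
  by rewrite (minn_idPr len) => /(parity_symbol_inj neqc); rewrite oddn.
have := wE (2 ^ (logn 2 i).+1).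
rewrite leq_exp2l // => /(_ ltn); rewrite /capped_ruler /ruler pfactorK //.
have -> : logn 2 (i + 2 ^ (logn 2 i).+1) = logn 2 i.
  symmetry; apply: (@logn2_mod (logn 2 i).+1); last by rewrite modnDr.
  by rewrite pfactor_dvdn // ltnn.
rewrite (minn_idPl ltn) (minn_idPl (ltnW ltn)) => /(parity_symbol_inj neqc) /=.
by case: odd.
Qed.

Lemma capped_ruler_pr n : c0 != c1 -> odd n -> is_pr (capped_ruler n) 1.
Proof.
move=> neqc oddn; split=> [|[|//]]; first exact: capped_ruler_sap_suffix.
by move/(capped_ruler_not_sap neqc oddn).
Qed.

Lemma capped_ruler_regulator n :
  regulator (capped_ruler n) (capped_regulator n).
Proof.
rewrite /capped_regulator; split=> k x sizex; case: ltnP => [ltkn|lenk].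
- apply: recurs_within_infinitely_often; rewrite sizex.
  exact: capped_ruler_recurs_short.
- move=> /(_ 1)[i i_gt0 /occurs_atP xE] j.
  have [i' /andP[ltj lei'] fE] := capped_ruler_recurs_pos n (size x) j i_gt0.
  by rewrite xE -fE; apply: infix_factor; lia.
- move=> finx j _; apply: recurs_within_finitely_often finx j.
  by rewrite sizex; apply: capped_ruler_recurs_short.
- move=> [N finx] j lej; apply/negP => /occurs_atP xE.
  have j_gt0 : 0 < j by lia.
  have [i' /andP[ltN _] fE] := capped_ruler_recurs_pos n (size x) N j_gt0.
  have /finx : occurs_at (capped_ruler n) x i' by apply/occurs_atP; rewrite fE.
  by rewrite ltnNge ltnW.
Qed.

End Witnesses.

Theorem theorem9 (Sigma : finType) (hSigma : 1 < #|Sigma|) :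
  ~ exists P : program,
      forall (w : nat -> Sigma) (f : nat -> nat) (l m : nat),
        eventually_strongly_almost_periodic w ->
        regulator w f ->
        is_pr w m ->
        m <= l ->
        halts_with_output P (sequence_oracle w) f l m.
Proof.
case=> P computes_pr.
have [c0 [c1 [_ _ neqc]]] := card_gt1P hSigma.
have full_pr := full_ruler_pr c0 c1.
(* The input [1] is an admissible bound for both sequences, so the two runs differ in their oracles
   alone. *)
have halt0 := computes_pr _ _ 1 0 (ex_intro _ 0 full_pr.1)
  (full_ruler_regulator c0 c1) full_pr (leq0n 1).
have [N contP] := halts_with_output_continuous halt0.
(* Any odd number above [N] would do: the sequences agree below [2 ^ n] and the regulators below
   [n]. *)
pose n := N.*2.+1.
have leNn : N < n by rewrite /n; lia.
have oddn : odd n by rewrite /n /= odd_double.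
have capped_pr := capped_ruler_pr neqc oddn.
have halt1 := computes_pr _ _ 1 1 (ex_intro _ 1 capped_pr.1)
  (capped_ruler_regulator c0 c1 n) capped_pr (leqnn 1).
suff halt0' : halts_with_output P (sequence_oracle (capped_ruler c0 c1 n))
    (capped_regulator n) 1 0.
  by have := halts_with_output_inj halt0' halt1.
apply: contP => i lti.
- rewrite /sequence_oracle capped_ruler_eq //.
  exact: ltn_trans (ltn_trans lti leNn) (ltn_expl n _).
- by rewrite /capped_regulator (ltn_trans lti leNn).
Qed.
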